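(* Each hereditarily paracompact scattered compact Hausdorff space $X$ of finite scattered height $s=\mathrm{ht}(X)$ is an absolute $F_{s+1}$-valued retract, where $F_{s+1}$ is the functor assigning to each compact Hausdorff space $Z$ the space $F_{s+1}(Z)$ of all functionals $\mu:C(Z)\to\mathbb R$ that preserve constants, are weakly multiplicative, weakly additive, weakly preserve order, and are $(2^{s+2}-1)$-Lipschitz.
   Context: For a compact Hausdorff space $Z$, $C(Z)$ is the space of continuous real-valued functions with the sup-norm $\|\cdot\|$, and $\mathbb R^{C(Z)}$ is the space of all functions (functionals) $\mu:C(Z)\to\mathbb R$ with the product topology. A functor $F$ of functionals has $F(Z)\subset\mathbb R^{C(Z)}$ with the subspace topology, and for a continuous map $f:Z\to Y$ the map $Ff:F(Z)\to F(Y)$ is $Ff(\mu)(\varphi)=\mu(\varphi\circ f)$. A functional $\mu:C(Z)\to\mathbb R$ preserves constants if $\mu(c_Z)=c$ for every constant function $c_Z\equiv c$; weakly preserves order if $\mu(a)\le\mu(f)\le\mu(b)$ for any $f\in C(Z)$ and constant functions $a,b$ with $a\le f\le b$; is weakly additive if $\mu(f+c)=\mu(f)+\mu(c)$ for all $f\in C(Z)$ and constant functions $c$; is weakly multiplicative if $\mu(c\cdot f)=\mu(c)\cdot\mu(f)$ for all $f\in C(Z)$ and constant functions $c$; is $k$-Lipschitz (for $k\ge 1$) if $|\mu(f)-\mu(g)|\le k\|f-g\|$ for all $f,g\in C(Z)$. For a closed subset $A\subset X$ with inclusion $i_A^X:A\to X$, ''$a\in FA\subset FX$'' means $a\in Fi_A^X(FA)$.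 A compact Hausdorff space $X$ is an absolute $F$-valued retract if for any embedding $X\subset Y$ into a compact Hausdorff space $Y$ there is a continuous map $r:Y\to FX$ such that $r(x)\in F(\{x\})\subset FX$ for every $x\in X$. A space is scattered if each nonempty subspace has an isolated point; hereditarily paracompact if each subspace is paracompact. For a space $A$, $A^{(1)}$ is the set of non-isolated points of $A$; $X^{(0)}=X$ and $X^{(\alpha)}=\bigcap_{\beta<\alpha}(X^{(\beta)})^{(1)}$ for ordinals $\alpha\ge1$. The scattered height $\mathrm{ht}(X)$ of a scattered compact space $X$ is the smallest ordinal $\alpha$ such that $X^{(\alpha)}$ is finite. *)

(* Defs.v *)
From mathcomp Require Import all_boot all_order all_algebra.
From mathcomp Require Import all_classical all_reals topology normedtype.

Set Implicit Arguments.
Unset Strict Implicit.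
Unset Printing Implicit Defensive.

Import Order.TTheory GRing.Theory Num.Theory.
Import numFieldNormedType.Exports.

Local Open Scope classical_set_scope.
Local Open Scope ring_scope.

Section topological_notions.
Context {X Y : topologicalType}.

(* [e] identifies [X] with a subspace of [Y]. *)
Definition embedding (e : X -> Y) : Prop :=
  injective e /\
  forall U : set X, open U <-> exists2 V : set Y, open V & e @^-1` V = U.

Definition locally_finite (F : set (set X)) : Prop :=
  forall x : X, exists2 W : set X, nbhs x W &
    finite_set [set V | F V /\ W `&` V !=set0].

(* Separation axioms are not part of this definition: in the theorem all the
   spaces concerned are subspaces of a Hausdorff space. *)
Definition paracompact : Prop :=
  forall G : set (set X),
    (forall U, G U -> open U) -> \bigcup_(U in G) U = [set: X] ->
    exists H : set (set X),
      [/\ forall V, H V -> open V,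
          \bigcup_(V in H) V = [set: X],
          locally_finite H &
          forall V, H V -> exists2 U, G U & V `<=` U].

Definition scattered : Prop :=
  forall A : set X, A !=set0 -> isolated A !=set0.

(* The set A^(1), where being isolated refers to the subspace A. *)
Definition nonisolated (A : set X) : set X := A `\` isolated A.

(* X^(n) for finite ordinals n; see [cb_derivativeE] for the formula as an
   intersection over all smaller ordinals. *)
Fixpoint cb_derivative (n : nat) : set X :=
  if n is m.+1 then nonisolated (cb_derivative m) else [set: X].

Lemma cb_derivativeE (n : nat) : (0 < n)%N ->
  cb_derivative n = \bigcap_(m < n) nonisolated (cb_derivative m).
Proof.
have dec m k : cb_derivative (m + k) `<=` cb_derivative m.
  elim: k => [|k IH]; first by rewrite addn0.
  by rewrite addnS => x [/IH].
case: n => // n _; rewrite eqEsubset; split=> [x nx m /= lemn|x]; last first.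
  by apply; rewrite /=.
by apply: (dec m.+1 (n - m)%N x); rewrite addSn subnKC.
Qed.

End topological_notions.

Arguments paracompact : clear implicits.
Arguments scattered : clear implicits.
Arguments cb_derivative : clear implicits.

Definition hereditarily_paracompact (X : topologicalType) : Prop :=
  forall A : set X, paracompact (set_type A).

(* ht(X) = s. Since s is finite, minimality among all ordinals amounts to
   minimality among the finite ones. *)
Definition scattered_height_is (X : topologicalType) (s : nat) : Prop :=
  finite_set (cb_derivative X s) /\
  forall t : nat, finite_set (cb_derivative X t) -> (s <= t)%N.

Section functionals.
Context {R : realType}.

Section continuous_functions.
Context {Z : topologicalType}.

Lemma cont_addc (f : continuousType Z R) (c : R) :
  continuous (fun z => f z + c).
Proof. by move=> z; apply: cvgD; [exact: (@cts_fun _ _ f) | exact: cvg_cst]. Qed.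

Lemma cont_scale (c : R) (f : continuousType Z R) :
  continuous (fun z => c * f z).
Proof. by move=> z; apply: cvgM; [exact: cvg_cst | exact: (@cts_fun _ _ f)]. Qed.

Definition const_fun (c : R) : continuousType Z R := cst c.
Definition add_const (f : continuousType Z R) (c : R) : continuousType Z R :=
  mkcts (@cont_addc f c).
Definition scale_fun (c : R) (f : continuousType Z R) : continuousType Z R :=
  mkcts (@cont_scale c f).

(* The sup-norm; a genuine supremum for continuous functions on a nonempty
   compact space (and 0 on the empty space). *)
Definition sup_norm (f : Z -> R) : R := sup [set `|f z| | z in [set: Z]].

End continuous_functions.

(* The space R^{C(Z)} with the product topology. *)
Definition functional (Z : topologicalType) : topologicalType :=
  {ptws continuousType Z R -> R}.

Definition pushforward {Z Y : topologicalType} (f : continuousType Z Y)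
    (mu : functional Z) : functional Y :=
  fun phi : continuousType Y R => mu (phi \o f).

Section properties.
Context {Z : topologicalType} (mu : functional Z).

Definition preserves_constants : Prop := forall c : R, mu (const_fun c) = c.

Definition weakly_preserves_order : Prop :=
  forall (f : continuousType Z R) (a b : R),
    (forall z, a <= f z <= b) -> mu (const_fun a) <= mu f <= mu (const_fun b).

Definition weakly_additive : Prop :=
  forall (f : continuousType Z R) (c : R),
    mu (add_const f c) = mu f + mu (const_fun c).

Definition weakly_multiplicative : Prop :=
  forall (f : continuousType Z R) (c : R),
    mu (scale_fun c f) = mu (const_fun c) * mu f.

Definition lipschitz_functional (k : R) : Prop :=
  forall f g : continuousType Z R, `|mu f - mu g| <= k * sup_norm (f \- g).

End properties.

(* The functor F_n, with Lipschitz constant 2^(n+1) - 1. *)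
Definition Fn (n : nat) (Z : topologicalType) : set (functional Z) :=
  [set mu | [/\ preserves_constants mu, weakly_multiplicative mu,
                weakly_additive mu, weakly_preserves_order mu &
                lipschitz_functional mu (2 ^+ n.+1 - 1)]].

Definition inclusion {X : topologicalType} (A : set X) :
    continuousType (set_type A) X :=
  mkcts (@initial_continuous (set_type A) X set_val).

(* The subset FA of FX, for a subset A of X. *)
Definition F_sub (F : forall Z : topologicalType, set (functional Z))
    (X : topologicalType) (A : set X) : set (functional X) :=
  pushforward (inclusion A) @` F (set_type A).

(* The codomain of [r] is F X with the topology of a subspace of R^{C(X)}. *)
Definition absolute_valued_retract
    (F : forall Z : topologicalType, set (functional Z))
    (X : topologicalType) : Prop :=
  forall (Y : topologicalType) (e : X -> Y),
    compact [set: Y] -> hausdorff_space Y -> embedding e ->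
    exists2 r : Y -> set_type (F X), continuous r &
      forall x : X, F_sub F [set x] (set_val (r (e x))).

End functionals.

Arguments functional : clear implicits.
Arguments Fn : clear implicits.

(* Main.v *)
(* Write D_n for the n-th Cantor-Bendixson derivative of X and embed X in Y.
   By induction on n, every clopen A in X with finite A ∩ D_n has an extension
   operator u : C(A) -> C(Y) whose point evaluations satisfy the axioms of the
   functor with Lipschitz constant 2^(n+1) - 1. Using partitions of unity we may
   assume that A ∩ D_n is a single point p. Paracompactness of A \ {p} and
   zero-dimensionality of X give a cover of A \ {p} by clopen sets C, locally
   finite in A \ {p}; as C misses D_n, it has an operator u_C with constant
   k = 2^n - 1. If h_C : Y -> [0,1] is 1 on C and 0 on X \ C, put
     u f = f p + sup_C (h_C (u_C f - f p))^+ - sup_C (h_C (u_C f - f p))^-.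
   The suprema replace the sums of a linear operator, since the sets where
   h_C > 0 cannot in general be made locally finite in Y. The Lipschitz constant
   becomes 2k + 1 = 2^(n+1) - 1. *)
Require Import Defs.
From mathcomp Require Import all_boot all_order all_algebra lra.
From mathcomp Require Import all_classical all_reals topology normedtype.

Set Implicit Arguments.
Unset Strict Implicit.
Unset Printing Implicit Defensive.

Import Order.TTheory GRing.Theory Num.Theory.
Import numFieldNormedType.Exports.

Local Open Scope classical_set_scope.
Local Open Scope ring_scope.

(** * Zero-dimensionality, derivatives and clopen covers in compact spaces *)

Section compact_spaces.
Context {X : topologicalType}.
Implicit Types (A K U : set X) (x : X).

(** Compactness as an induction principle. The sets outside which [K] satisfies [Q] form a filter;
    if [Q K] failed, it would be proper and cluster at some [x] in [K], yet it contains the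
    complement of a neighbourhood of [x]. *)
Lemma compact_set_ind (Q : set X -> Prop) K :
  compact K -> Q set0 -> (forall A B, A `<=` B -> Q B -> Q A) ->
  (forall A B, Q A -> Q B -> Q (A `|` B)) ->
  (forall x, K x -> exists2 W, nbhs x W & Q W) -> Q K.
Proof.
move=> cK Q0 QS QU Qloc; apply: contrapT => nQK.
pose F : set_system X := [set A | Q (K `\` A)].
have FF : Filter F.
  split; first by rewrite /F/= setDT.
    by move=> A B FA FB; rewrite /F/= setDIr; exact: QU.
  by move=> A B AB; apply: QS; exact: setDS.
have PF : ProperFilter F by split=> //; rewrite /F/= setD0.
have FK : F K by rewrite /F/= setDv.
have [x [Kx clx]] := cK F PF FK.
have [W xW QW] := Qloc x Kx.
have FW : F (~` W) by apply: QS QW => y [_ /contrapT].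
by have [y [nWy Wy]] := clx _ _ FW xW.
Qed.

Lemma compact_locally_finite_trace K (H : set (set X)) :
  compact K ->
  (forall x, K x -> exists2 W, nbhs x W &
     finite_set [set V | H V /\ V `&` W !=set0]) ->
  finite_set [set V | H V /\ V `&` K !=set0].
Proof.
pose Q A := finite_set [set V | H V /\ V `&` A !=set0].
move=> cK; apply: (@compact_set_ind Q) => //; rewrite /Q.
- by apply: (sub_finite_set _ (finite_set0 _)) => V [_ [y []]].
- move=> A B AB; apply: sub_finite_set => V [HV [y [Vy Ay]]]; split=> //.
  by exists y; split=> //; exact: AB.
- move=> A B fA fB; have := conj fA fB; rewrite -finite_setU.
  apply: sub_finite_set => V [HV [y [Vy [Ay|By]]]]; [left|right];
  by split=> //; exists y.
Qed.

Hypotheses (Xc : compact [set: X]) (Xh : hausdorff_space X).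

Let closed_cpt K : closed K -> compact K.
Proof. by move=> clK; apply: (subclosed_compact clK Xc). Qed.

(** Let [p] be isolated in the quasi-component [Q] of [x], and [U] a neighbourhood of [p] whose
    closure misses the rest of [Q]. By compactness some clopen [C] around [x] misses the boundary of
    [U]. Then [C] cuts out of the interior of [U] a clopen set meeting [Q] in [p] alone, which is
    absurd if [Q] has two points. *)
Lemma scattered_zero_dimensional : scattered X -> zero_dimensional X.
Proof.
move=> Xs x z /eqP xz; apply: contrapT => nosep.
pose Q := [set y | forall C, clopen C -> C x -> C y].
have Qx : Q x by move=> C.
have Qz : Q z by move=> C cC Cx; apply: contrapT => nCz; apply: nosep; exists C.
have clQ : closed Q.
  have -> : Q = \bigcap_(C in [set C | clopen C /\ C x]) C.
    apply/seteqP; split=> y Qy C; first by case=> cC Cx; exact: Qy.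
    by move=> cC Cx; exact: Qy.
  by apply: closed_bigI => C [[]].
have [p [/set_mem Qp [W pW WQ]]] := Xs Q (ex_intro _ x Qx).
have clQp : closed (Q `\` [set p]).
  have -> : Q `\` [set p] = Q `&` ~` (interior W).
    apply/seteqP; split=> y [Qy ny]; split=> //.
      move=> /interior_subset Wy; apply: ny.
      by rewrite /= -[_ = _]/([set p] y) -WQ.
    by move=> yp; apply: ny; rewrite yp.
  by apply: closedI => //; apply: open_closedC; exact: open_interior.
have [U pU clU] : exists2 U, nbhs p U & closure U `<=` ~` (Q `\` [set p]).
  have [|U pU] := @compact_regular X p setT Xh Xc filterT (~` (Q `\` [set p])).
    apply: open_nbhs_nbhs; split; first exact: closed_openC.
    by move=> -[_ /(_ erefl)].
  by exists U.
have [C [cC Cx CU]] : exists C,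
    [/\ clopen C, C x & C `<=` interior U `|` ~` closure U].
  pose K := ~` (interior U `|` ~` closure U).
  have cK : compact K.
    apply: closed_cpt; apply: open_closedC.
    apply: openU; first exact: open_interior.
    by apply: closed_openC; exact: closed_closure.
  have [C [cC Cx CK]] : exists C, [/\ clopen C, C x & C `&` K = set0].
    pose sep B := exists C, [/\ clopen C, C x & C `&` B = set0].
    apply: (@compact_set_ind sep) => //.
    - by exists setT; split; [exact: clopenT| | rewrite setI0].
    - move=> A B AB [C [cC Cx CB]]; exists C; split=> //.
      by apply/disjoints_subset => y Cy /AB By; rewrite -[False]/(set0 y) -CB.
    - move=> A B [C [cC Cx CA]] [D [cD Dx DB]]; exists (C `&` D); split=> //.
        exact: clopenI.
      by rewrite setIUr setIAC CA set0I set0U -setIA DB setI0.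
    - move=> y Ky; apply: contrapT => nW; apply: Ky.
      have Qy : Q y.
        move=> C cC Cx; apply: contrapT => nCy; apply: nW; exists (~` C).
          apply: open_nbhs_nbhs; split=> //; apply: closed_openC; exact: cC.2.
        by exists C; split=> //; rewrite setICr.
      have [->|yp] := pselect (y = p); first by left.
      by right=> /clU; apply.
  exists C; split=> // y Cy; apply: contrapT => nU.
  by rewrite -[False]/(set0 y) -CK.
have disj y : interior U y -> ~ closure U y -> False.
  by move=> /interior_subset /subset_closure.
have cCU : clopen (C `&` interior U).
  split; first by apply: openI; [exact: cC.1 | exact: open_interior].
  have -> : C `&` interior U = C `&` closure U.
    apply/seteqP; split=> y [Cy Uy]; split=> //.
      exact: subset_closure (interior_subset Uy).
    by case: (CU y Cy).
  by apply: closedI; [exact: cC.2 | exact: closed_closure].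
have Qp' y : y != p -> Q y -> ~ closure U y by move=> /eqP yp Qy /clU; apply.
have [xp|/Qp'] := eqVneq x p.
  have [|_ /interior_subset/subset_closure] := Qz _ cCU.
    by split=> //; rewrite xp; exact: pU.
  by apply: Qp' => //; rewrite -xp eq_sym; exact/eqP.
move=> /(_ Qx) xU.
have [|_] := Qp _ (clopenI cC (clopenC setT cCU)).
  by split=> // -[_ /interior_subset/subset_closure]; exact: xU.
by apply; split; [exact: Qp | exact: pU].
Qed.

Lemma discrete_trace_finite K D :
  closed K -> closed D -> (forall x, K x -> D x -> isolated D x) ->
  finite_set (K `&` D).
Proof.
move=> /closed_cpt cK clD iD.
suff : finite_set (D `&` K) by rewrite setIC.
apply: (@compact_set_ind (fun A => finite_set (D `&` A)) K) => //.
- by rewrite setI0.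
- by move=> A B AB; apply: sub_finite_set; exact: setIS.
- by move=> A B fA fB; rewrite setIUr finite_setU.
- move=> x Kx; have [Dx|nDx] := pselect (D x).
    have [_ [W xW WD]] := iD x Kx Dx.
    by exists W => //; rewrite setIC WD; exact: finite_set1.
  exists (~` D); last by rewrite setICr.
  by apply: open_nbhs_nbhs; split=> //; exact: closed_openC.
Qed.

Lemma closed_nonisolated (D : set X) : closed D -> closed (nonisolated D).
Proof.
move=> clD; rewrite /nonisolated.
(* The isolated points of [D] are its points in the union of the open sets that meet [D] in at most
   one point. *)
pose O := [set V | open V /\ exists x, V `&` D `<=` [set x]].
have -> : D `\` isolated D = D `&` ~` \bigcup_(V in O) V.
  apply/seteqP; split=> x [Dx nx]; split=> //.
    move=> [V [oV [y VD]] Vx]; apply: nx; split; first exact: mem_set.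
    exists V; first exact: open_nbhs_nbhs.
    have xy : x = y by exact: VD.
    by apply/seteqP; split=> [z /VD -> //| _ -> //].
  move=> [_ [W xW WD]]; apply: nx.
  exists (interior W); last exact: xW.
  split; first exact: open_interior.
  by exists x => y [/interior_subset Wy Dy]; rewrite -WD.
apply: closedI => //; apply: open_closedC; apply: bigcup_open.
by move=> V [].
Qed.

Lemma closed_cb_derivative n : closed (cb_derivative X n).
Proof. by elim: n => [|n IH]; [exact: closedT | exact: closed_nonisolated]. Qed.

(** Carries paracompactness of the subspace [U] over to open sets of [X]. Local finiteness becomes
    finiteness of traces on closed sets [K] inside [U], because these are compact. *)
Lemma paracompact_refinement (U : set X) (G : set (set X)) :
  open U -> paracompact (set_type U) ->
  (forall V, G V -> open V) -> \bigcup_(V in G) V = U ->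
  exists H : set (set X),
    [/\ forall V, H V -> open V, \bigcup_(V in H) V = U,
        (forall V, H V -> exists2 W, G W & V `<=` W) &
        (forall K, closed K -> K `<=` U ->
           finite_set [set V | H V /\ V `&` K !=set0])].
Proof.
move=> oU pU oG GU.
pose i : set_type U -> X := set_val.
have open_image (V : set (set_type U)) : open V -> open (i @` V).
  move=> [W oW <-]; have -> : i @` (i @^-1` W) = U `&` W.
    apply/seteqP; split=> [_ [x Wx <-]|x [Ux Wx]].
      by split=> //; exact: set_valP.
    by exists (SigSub (mem_set Ux)).
  exact: openI.
have [V [W GW <-]||H [oH cH lH rH]] := pU [set i @^-1` V | V in G].
- by exists W => //; exact: oG.
- apply/seteqP; split=> // x _.
  have : (\bigcup_(V in G) V) (i x) by rewrite GU; exact: set_valP.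
  by move=> -[V GV Vx]; exists (i @^-1` V) => //; exists V.
exists [set i @` V | V in H]; split.
- by move=> _ [V /oH oV <-]; exact: open_image.
- apply/seteqP; split=> [x [_ [V HV <-] [y Vy <-]]|x Ux]; first exact: set_valP.
  have : [set: set_type U] (SigSub (mem_set Ux)) by [].
  rewrite -cH => -[V HV Vx]; exists (i @` V); first by exists V.
  by exists (SigSub (mem_set Ux)).
- move=> _ [V HV <-]; have [_ [W GW <-] VW] := rH V HV.
  by exists W => // _ [x Vx <-]; exact: VW.
move=> K /closed_cpt cK KU; apply: compact_locally_finite_trace => // x Kx.
pose x' : set_type U := SigSub (mem_set (KU x Kx)).
have [W + fW] := lH x'.
rewrite nbhsE => -[W' [oW' W'x] W'W].
exists (i @` W).
  apply: (@filterS _ (nbhs x) _ (i @` W')); first exact: image_subset.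
  apply: open_nbhs_nbhs; split; first exact: open_image.
  by exists x'.
apply: (sub_finite_set _ (finite_image (fun V => i @` V) fW)).
move=> _ [[V HV <-] [_ [[y Vy <-] [z Wz zy]]]].
exists V => //; split=> //; exists y; split=> //.
by rewrite -(val_inj zy).
Qed.

(* The second refinement makes the compact open enlargements of its members
   lie inside members of the first one, so the enlargements inherit local
   finiteness. *)
Lemma compact_open_cover (U : set X) :
  zero_dimensional X -> open U -> paracompact (set_type U) ->
  exists CC : set (set X),
    [/\ U = \bigcup_(C in CC) C,
        (forall C, CC C -> [/\ clopen C, C !=set0 & C `<=` U]) &
        (forall K, closed K -> K `<=` U ->
           finite_set [set C | CC C /\ C `&` K !=set0])].
Proof.
move=> zX oU pU.
have base x V : open V -> V x -> exists C, [/\ clopen C, C x & C `<=` V].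
  move=> oV Vx.
  have [C [Cx cC] CV] :=
    zero_dimensional_cvg Xh zX Xc (open_nbhs_nbhs (conj oV Vx)).
  by exists C.
have [||H [oH HU rH lH]] := @paracompact_refinement U
    [set C | clopen C /\ C `<=` U] oU pU.
- by move=> V [[]].
- apply/seteqP; split=> [x [V [_ VU] /VU//]|x Ux].
  by have [C [cC Cx CU]] := base x U oU Ux; exists C.
have HsU V : H V -> V `<=` U by move=> HV x Vx; rewrite -HU; exists V.
have [||H' [_ H'U rH' lH']] := @paracompact_refinement U
    [set C | clopen C /\ exists2 V, H V & C `<=` V] oU pU.
- by move=> V [[]].
- apply/seteqP; split=> [x [C [_ [V /HsU VU CV]] /CV/VU//]|x Ux].
  have [V HV Vx] : (\bigcup_(V in H) V) x by rewrite HU.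
  have [C [cC Cx CV]] := base x V (oH V HV) Vx.
  by exists C => //; split=> //; exists V.
have /choice[W rW] V : exists W, H V -> [/\ clopen W, W `<=` U & V `<=` W].
  have [/rH [W [cW WU] VW]|nH] := pselect (H V); first by exists W.
  by exists set0.
have /choice[O rO] V : exists O, H' V ->
    [/\ clopen O, exists2 V', H V' & O `<=` V' & V `<=` O].
  have [/rH' [C [cC CH] VC]|nH] := pselect (H' V); first by exists C.
  by exists set0.
exists [set O V | V in [set V | H' V /\ V !=set0]]; split.
- apply/seteqP; split=> x; last first.
    by move=> [_ [V [/rO[_ [V' /HsU V'U OV'] _] _] <-] /OV'/V'U].
  rewrite -{1}H'U => -[V HV Vx].
  exists (O V); last by have [_ _] := rO V HV; exact.
  by exists V => //; split=> //; exists x.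
- move=> _ [V [HV [x Vx]] <-]; have [cO [V' HV' OV'] VO] := rO V HV.
  split=> //; first by exists x; exact: VO.
  exact: subset_trans (HsU _ HV').
move=> K cK KU.
(* Finitely many members of [H] meet [K]. Each lies in a compact [W V] inside [U], which meets
   finitely many members of [H']; every enlargement that meets [K] comes from one of those. *)
pose S := [set V | H V /\ V `&` K !=set0].
have fS : finite_set (\bigcup_(V in S) [set V' | H' V' /\ V' `&` W V !=set0]).
  apply: bigcup_finite; first exact: lH.
  by move=> V [/rW[[_ cW] WU _] _]; exact: lH'.
apply: (sub_finite_set _ (finite_image O fS)).
move=> _ [[V [HV [x Vx]] <-] [y [Oy Ky]]]; exists V => //.
have [_ [V' HV' OV'] VO] := rO V HV; exists V'.
  by split=> //; exists y; split=> //; exact: OV'.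
split=> //; exists x; split=> //; have [_ _] := rW V' HV'; apply.
exact/OV'/VO.
Qed.

End compact_spaces.

(** * Suprema of families with 0 adjoined *)

Section supremum_with_zero.
Context {R : realType} {I : Type}.
Implicit Types (D : set I) (v : I -> R).

(** For a family bounded above this is the supremum of the positive parts, and it is 0 for the empty
    family. *)
Definition sup0 D v : R := sup (0 |` [set v i | i in D]).

Lemma sup0_ge0 D v M : (forall i, D i -> v i <= M) -> 0 <= sup0 D v.
Proof.
move=> vM; apply: ub_le_sup; last by left.
by exists (Num.max 0 M) => _ [->|[i Di <-]]; rewrite le_max ?lexx ?vM ?orbT.
Qed.

Lemma sup0_ub D v M i : (forall i, D i -> v i <= M) -> D i -> v i <= sup0 D v.
Proof.
move=> vM Di; apply: ub_le_sup; last by right; exists i.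
by exists (Num.max 0 M) => _ [->|[j Dj <-]]; rewrite le_max ?lexx ?vM ?orbT.
Qed.

Lemma sup0_le D v m : 0 <= m -> (forall i, D i -> v i <= m) -> sup0 D v <= m.
Proof.
move=> m0 vm; apply: ge_sup; first by exists 0; left.
by move=> _ [->|[i Di <-]] //; exact: vm.
Qed.

Lemma eq_sup0 D v w : (forall i, D i -> v i = w i) -> sup0 D v = sup0 D w.
Proof. by move=> vw; rewrite /sup0 (eq_imagel vw). Qed.

Lemma sup0Z D v M c : 0 <= c -> (forall i, D i -> v i <= M) ->
  sup0 D (fun i => c * v i) = c * sup0 D v.
Proof.
rewrite le_eqVlt => /predU1P[<- _|c0 vM].
  rewrite mul0r; apply/eqP; rewrite eq_le.
  rewrite sup0_le //=; last by move=> i _; rewrite mul0r.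
  by apply: (@sup0_ge0 _ _ 0) => i _; rewrite mul0r.
have cvM i : D i -> c * v i <= c * M by move=> /vM; rewrite ler_pM2l.
apply/eqP; rewrite eq_le; apply/andP; split.
  apply: sup0_le; first by rewrite mulr_ge0 ?(ltW c0) ?(sup0_ge0 vM).
  by move=> i Di; rewrite ler_pM2l // (sup0_ub vM).
rewrite mulrC -ler_pdivlMr //; apply: sup0_le.
  by rewrite divr_ge0 ?(ltW c0) // (sup0_ge0 cvM).
by move=> i Di; rewrite ler_pdivlMr // mulrC (sup0_ub cvM).
Qed.

End supremum_with_zero.

Section extension_operators.
Context {R : realType} {X Y : topologicalType} (e : X -> Y).
Implicit Types (A B C : set X) (k : R) (u : (X -> R) -> Y -> R)
  (f g : X -> R) (a b c d : R) (y : Y).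

(* The functionals [u _ y] depend only on the restriction of their argument to
   [A]; taking them on C(X) avoids working with C(A). *)
Record extension_operator A k u : Prop := ExtensionOperator {
  ext_continuous : forall f, continuous f -> continuous (u f);
  ext_id : forall f x, continuous f -> A x -> u f (e x) = f x;
  ext_scale : forall f c y, continuous f -> u (fun x => c * f x) y = c * u f y;
  ext_add : forall f c y, continuous f -> u (fun x => f x + c) y = u f y + c;
  ext_order : forall f a b y, continuous f ->
    (forall x, A x -> a <= f x <= b) -> a <= u f y <= b;
  ext_lipschitz : forall f g d y, continuous f -> continuous g ->
    (forall x, A x -> `|f x - g x| <= d) -> `|u f y - u g y| <= k * d }.

Lemma ext_opp A k u f y : extension_operator A k u -> continuous f ->
  u (fun x => - f x) y = - u f y.
Proof.
move=> uE cf; rewrite -mulN1r -(ext_scale uE) //; congr (u _ y).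
by apply/funext => x; rewrite mulN1r.
Qed.

(** A point of [A] forces [d >= 0], so that [k * d <= l * d]. *)
Lemma ext_le A k l u : k <= l -> A !=set0 ->
  extension_operator A k u -> extension_operator A l u.
Proof.
move=> kl [a Aa] [uc ui us ua uo ul]; split=> // f g d y cf cg fg.
apply: le_trans (ul f g d y cf cg fg) _.
by rewrite ler_wpM2r // (le_trans _ (fg a Aa)).
Qed.

Hypotheses (Xc : compact [set: X]) (Yc : compact [set: Y]).
Hypotheses (Yh : hausdorff_space Y) (eE : embedding e).

Lemma embedding_continuous : continuous e.
Proof. by apply/continuousP => V oV; apply/(eE.2 _).2; exists V. Qed.

(** Urysohn's lemma in [Y] for the images of [C] and of its complement, which are disjoint and
    compact. *)
Lemma clopen_bump C : clopen C -> exists h : Y -> R, [/\ continuous h,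
  forall y, 0 <= h y <= 1, forall x, C x -> h (e x) = 1 &
  forall x, ~ C x -> h (e x) = 0].
Proof.
move=> [oC cC].
have clim K : closed K -> closed (e @` K).
  move=> cK; apply: compact_closed => //; apply: continuous_compact.
    exact/continuous_subspaceT/embedding_continuous.
  exact: subclosed_compact cK Xc _.
have disj : e @` (~` C) `&` e @` C = set0.
  rewrite -subset0 => _ [[x nCx <-] [z Cz zx]]; apply: nCx.
  by rewrite -(eE.1 _ _ zx).
have /(@normal_separatorP R) nY := compact_normal Yh Yc.
have /(@uniform_separatorP _ R)[h [ch h01 h0 h1]] :=
  nY _ _ (clim _ (open_closedC oC)) (clim _ cC) disj.
exists h; split=> // [y|x Cx|x nCx].
- by have /h01 : range h (h y) by exists y.
- by apply: h1; exists (e x) => //; exists x.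
- by apply: h0; exists (e x) => //; exists x.
Qed.

Lemma continuous_bounded (f : X -> R) :
  continuous f -> exists M, forall x, `|f x| <= M.
Proof.
move=> cf.
suff [M fM] : exists M, forall x, [set: X] x -> `|f x| <= M.
  by exists M => x; exact: fM.
pose Q A := exists M, forall x, A x -> `|f x| <= M.
apply: (compact_set_ind (Q := Q)) => //.
- by exists 0.
- by move=> A B AB [M BM]; exists M => x /AB /BM.
- move=> A B [M AM] [N BN]; exists (Num.max M N) => x [/AM fM|/BN fN].
    by rewrite le_max fM.
  by rewrite le_max fN orbT.
- move=> x _; exists [set y | `|f y - f x| < 1].
    have := cf x; move/cvgrPdist_lt => /(_ 1 ltr01); apply: filterS => y.
    by rewrite /= distrC.
  exists (1 + `|f x|) => y /= fy; rewrite -[f y](subrK (f x)).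
  by rewrite (le_trans (ler_normD _ _)) // lerD2r ltW.
Qed.

(** The two operators are averaged with the weights [h] and [1 - h], where [h] is 1 on [B] and 0 on
    [C]. Convex combinations preserve all the axioms and do not increase the Lipschitz constant. *)
Lemma extension_union B C k : clopen B -> clopen C -> B `&` C = set0 ->
  B !=set0 -> C !=set0 -> 0 <= k ->
  (exists u, extension_operator B k u) ->
  (exists u, extension_operator C k u) ->
  exists u, extension_operator (B `|` C) k u.
Proof.
move=> cB cC BC0 [b Bb] [c Cc] k0 [u uE] [v vE].
have [h [ch h01 h1 h0]] := clopen_bump cB.
exists (fun f y => h y * u f y + (1 - h y) * v f y); split.
- move=> f cf y; apply: cvgD; apply: cvgM.
  + exact: ch.
  + exact: (ext_continuous uE).
  + by apply: cvgB; [exact: cvg_cst | exact: ch].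
  + exact: (ext_continuous vE).
- move=> f x cf [Bx|Cx].
    by rewrite h1 // (ext_id uE) //; lra.
  rewrite h0 ?(ext_id vE) //; first lra.
  by move=> Bx; rewrite -[False]/(set0 x) -BC0.
- by move=> f t y cf; rewrite (ext_scale uE) // (ext_scale vE) //; lra.
- by move=> f t y cf; rewrite (ext_add uE) // (ext_add vE) //; lra.
- move=> f s t y cf fst.
  have /andP[u1 u2] : s <= u f y <= t.
    by apply: (ext_order uE) => // x Bx; apply: fst; left.
  have /andP[v1 v2] : s <= v f y <= t.
    by apply: (ext_order vE) => // x Bx; apply: fst; right.
  have /andP[h2 h3] := h01 y.
  by apply/andP; split; nra.
- move=> f g d y cf cg fg.
  have : `|u f y - u g y| <= k * d.
    by apply: (ext_lipschitz uE) => // x Bx; apply: fg; left.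
  have : `|v f y - v g y| <= k * d.
    by apply: (ext_lipschitz vE) => // x Bx; apply: fg; right.
  have /andP[h2 h3] := h01 y.
  rewrite !ler_norml => /andP[v1 v2] /andP[u1 u2].
  by apply/andP; split; nra.
Qed.


(** * Extension from a clopen cover of the complement of a point *)

Section cone.
Variables (A : set X) (p : X) (CC : set (set X)) (k : R).
Variables (h : set X -> Y -> R) (U : set X -> (X -> R) -> Y -> R).
Hypotheses (k0 : 0 <= k) (cA : closed A) (Ap : A p).
Hypothesis CCcover : A `\` [set p] = \bigcup_(C in CC) C.
Hypothesis CCfinite : forall K, closed K -> K `<=` A `\` [set p] ->
  finite_set [set C | CC C /\ C `&` K !=set0].
Hypothesis hC : forall C, CC C -> [/\ continuous (h C),
  forall y, 0 <= h C y <= 1, forall x, C x -> h C (e x) = 1 &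
  forall x, ~ C x -> h C (e x) = 0].
Hypothesis UE : forall C, CC C -> extension_operator C k (U C).

Let v f y C : R := h C y * (U C f y - f p).
Let P f y : R := sup0 CC (v f y).
(** Since [v] is odd in [f], the last term is the supremum of the negative parts. *)
Let u f y : R := f p + P f y - P (fun x => - f x) y.

Let CA C x : CC C -> C x -> A x.
Proof.
move=> CCC Cx; suff [] : (A `\` [set p]) x by [].
by rewrite CCcover; exists C.
Qed.

Let v_opp f y C : continuous f -> CC C -> v (fun x => - f x) y C = - v f y C.
Proof. by move=> cf CCC; rewrite /v (ext_opp _ (UE CCC)) //; lra. Qed.

Let v_le f (b : R) y C : continuous f -> 0 <= b -> CC C ->
  (forall x, C x -> f x - f p <= b) -> v f y C <= b.
Proof.
move=> cf b0 CCC fb; have [_ h01 _ _] := hC CCC.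
have [M fM] := continuous_bounded cf.
have /andP[_ Ub] : - M <= U C f y <= f p + b.
  apply: (ext_order (UE CCC)) => // x Cx.
  have := fM x; rewrite ler_norml => /andP[-> _].
  by have := fb x Cx; lra.
by have /andP[h2 h3] := h01 y; rewrite /v; nra.
Qed.

Let v_bounded f : continuous f -> exists M, forall y C, CC C -> v f y C <= M.
Proof.
move=> cf; have [M fM] := continuous_bounded cf.
exists (2 * M) => y C CCC; have M0 := le_trans (normr_ge0 _) (fM p).
apply: v_le => // [|x _]; first lra.
by have := fM x; have := fM p; rewrite !ler_norml => /andP[? ?] /andP[? ?]; lra.
Qed.

Let continuousN f : continuous f -> continuous (fun x => - f x).
Proof. by move=> cf x; apply: cvgN; exact: cf. Qed.

Let P_ge0 f y : continuous f -> 0 <= P f y.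
Proof. by move=> /v_bounded[M vM]; apply: sup0_ge0 (vM y). Qed.

Let P_ub f y C : continuous f -> CC C -> v f y C <= P f y.
Proof. by move=> /v_bounded[M vM]; exact: sup0_ub (vM y). Qed.

(* Only finitely many pieces meet the compact set where [f - f p >= t]. *)
Let P_continuous f : continuous f -> continuous (P f).
Proof.
move=> cf y; apply/cvgrPdist_le => /= t t0.
pose K := A `&` [set x | f p + t <= f x].
have cK : closed K.
  apply: closedI => //; move/continuous_closedP : (cf).
  move=> /(_ _ (@closed_ge R (f p + t))); exact.
have KA : K `<=` A `\` [set p].
  by move=> x [Ax /= fx]; split=> // xp; move: fx; rewrite xp; lra.
(* On a piece missing [K], [f - f p] is below [t]; [v_le] carries the bound [t] over to all of
   [Y]. *)
have small z C : CC C -> C `&` K = set0 -> v f z C <= t.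
  move=> CCC CK; apply: v_le => //; first exact: ltW.
  move=> x Cx; rewrite leNgt; apply/negP => fx.
  rewrite -[False]/(set0 x) -CK; split=> //.
  by split; [exact: CA Cx | rewrite /=; lra].
have near_all : \forall z \near y, forall C, CC C /\ C `&` K !=set0 ->
    `|v f y C - v f z C| <= t.
  have /finite_fsetP[F FE] := CCfinite cK KA.
  pose B C := [set z | `|v f y C - v f z C| <= t].
  have : nbhs y (\bigcap_(C in [set C | CC C /\ C `&` K !=set0]) B C).
    rewrite FE; apply: filter_bigI => C CF.
    have [CCC _] : [set C | CC C /\ C `&` K !=set0] C by rewrite FE.
    have [ch _ _ _] := hC CCC.
    have : {for y, continuous (fun z => v f z C)}.
      apply: cvgM; first exact: ch.
      by apply: cvgB; [exact: (ext_continuous (UE CCC)) | exact: cvg_cst].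
    by move=> /cvgrPdist_le /(_ t t0).
  by apply: filterS => z zB C CCC; exact: zB.
(* Terms of pieces missing [K] are at most [t], hence at most [P f z' + t], as [P] is
   nonnegative. *)
have half z z' :
    (forall C, CC C /\ C `&` K !=set0 -> `|v f z C - v f z' C| <= t) ->
    P f z <= P f z' + t.
  move=> zz'; have Pz'0 := P_ge0 z' cf; apply: sup0_le; first lra.
  move=> C CCC; have [CK|/set0P CK] := eqVneq (C `&` K) set0; last first.
    have := zz' C (conj CCC CK); rewrite ler_norml => /andP[_ ?].
    by have := P_ub z' cf CCC; lra.
  by have := small z C CCC CK; lra.
apply: filterS near_all => z zC; rewrite ler_norml.
have := half y z zC; have := half z y.
move=> /(_ (fun C CCC => ltac:(rewrite distrC; exact: zC))) ? ?.
by apply/andP; split; lra.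
Qed.

(** At [e x] each [h C] is 1 or 0 according to whether [C] contains [x], so every term is
    [f x - f p] or 0. With [max 0 t - max 0 (- t) = t] this shows that [u] extends [f]. *)
Let P_id f x : continuous f -> A x -> P f (e x) = Num.max 0 (f x - f p).
Proof.
move=> cf Ax.
have vE C : CC C -> C x -> v f (e x) C = f x - f p.
  move=> CCC Cx; have [_ _ h1 _] := hC CCC.
  by rewrite /v h1 // (ext_id (UE CCC)) // mul1r.
apply/eqP; rewrite eq_le; apply/andP; split.
  apply: sup0_le => [|C CCC]; first by rewrite le_max lexx.
  have [Cx|nCx] := pselect (C x); first by rewrite vE // le_max lexx orbT.
  by have [_ _ _ h0] := hC CCC; rewrite /v h0 // mul0r le_max lexx.
rewrite ge_max P_ge0 //=; have [->|/eqP xp] := eqVneq x p.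
  by rewrite subrr P_ge0.
have : (A `\` [set p]) x by [].
by rewrite CCcover => -[C CCC Cx]; rewrite -(vE C) // P_ub.
Qed.

Let P_scale f c y : continuous f -> 0 <= c ->
  P (fun x => c * f x) y = c * P f y.
Proof.
move=> cf c0; have [M vM] := v_bounded cf.
rewrite -(sup0Z c0 (vM y)); apply: eq_sup0 => C CCC.
by rewrite /v (ext_scale (UE CCC)) //; lra.
Qed.

Let P_add f c y : continuous f -> P (fun x => f x + c) y = P f y.
Proof.
move=> cf; apply: eq_sup0 => C CCC.
by rewrite /v (ext_add (UE CCC)) //; congr (_ * _); lra.
Qed.

(** The coefficient [1 - a - b] may be negative but lies in [-1, 1]; the three terms are thus at
    most [d], [k * d] and [k * d]. *)
Let lipschitz_term (a b x y z d : R) : 0 <= a <= 1 -> 0 <= b <= 1 ->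
  `|x| <= d -> `|y| <= k * d -> `|z| <= k * d ->
  (1 - a - b) * x + a * y + b * z <= (2 * k + 1) * d.
Proof.
move=> /andP[a0 a1] /andP[b0 b1] xd yd zd.
have d0 := le_trans (normr_ge0 _) xd; have kd0 := mulr_ge0 k0 d0.
have x1 : (1 - a - b) * x <= d.
  apply: le_trans (ler_norm _) _; rewrite normrM.
  have ab1 : `|1 - a - b| <= 1 by rewrite ler_norml; apply/andP; split; lra.
  by rewrite -[leRHS]mul1r ler_pM.
have y1 : a * y <= k * d by have := ler_norm y; nra.
have z1 : b * z <= k * d by have := ler_norm z; nra.
lra.
Qed.

(* A pair of terms of the two suprema contributes
   (1 - a - b) (f p) + a (U C f y) + b (U D f y) with a, b in [0, 1]; hence the
   constant 1 + 2k. *)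
Let u_le f g d y : continuous f -> continuous g ->
  (forall x, A x -> `|f x - g x| <= d) -> u f y - u g y <= (2 * k + 1) * d.
Proof.
move=> cf cg fg; have cNf := continuousN cf; have cNg := continuousN cg.
have pd := fg p Ap.
have Ud C : CC C -> `|U C f y - U C g y| <= k * d.
  move=> CCC; apply: (ext_lipschitz (UE CCC)) => // x Cx.
  exact: fg (CA CCC Cx).
have pair (a b q q' r r' : R) :
    0 <= a <= 1 -> 0 <= b <= 1 -> `|q - q'| <= k * d -> `|r - r'| <= k * d ->
    f p + a * (q - f p) + b * (r - f p) <=
    g p + a * (q' - g p) + b * (r' - g p) + (2 * k + 1) * d.
  by move=> a01 b01 qd rd; have := lipschitz_term a01 b01 pd qd rd; lra.
(* Weight 0 accounts for the element 0 adjoined in each supremum. *)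
have zero01 : (0 : R) <= 0 <= (1 : R).
  by rewrite lexx ler01.
have kd0 : `|0 - 0 : R| <= k * d.
  by rewrite subrr normr0 mulr_ge0 // (le_trans _ pd).
(* One term of the first supremum is kept fixed while the second is bounded term by term; the first
   is then treated in the same way. *)
have key (a q q' : R) : 0 <= a <= 1 -> `|q - q'| <= k * d ->
    f p + a * (q - f p) <= g p + a * (q' - g p) + P (fun x => - f x) y
      - P (fun x => - g x) y + (2 * k + 1) * d.
  move=> a01 qd.
  suff : P (fun x => - g x) y <= g p + a * (q' - g p) + P (fun x => - f x) y
      + (2 * k + 1) * d - (f p + a * (q - f p)) by lra.
  apply: sup0_le.
    have := pair a 0 q q' 0 0 a01 zero01 qd kd0.
    by have := P_ge0 y cNf; lra.
  move=> D CCD; have [_ h01 _ _] := hC CCD.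
  have := pair a (h D y) q q' _ _ a01 (h01 y) qd (Ud D CCD).
  have := P_ub y cNf CCD; rewrite !v_opp // /v; lra.
suff : P f y <= u g y + (2 * k + 1) * d - f p + P (fun x => - f x) y.
  by rewrite /u; lra.
apply: sup0_le.
  have := key 0 0 0 zero01 kd0; have := P_ge0 y cg; rewrite /u; lra.
move=> C CCC; have [_ h01 _ _] := hC CCC.
have := key (h C y) _ _ (h01 y) (Ud C CCC).
have := P_ub y cg CCC; rewrite /u /v; lra.
Qed.

Lemma extension_cone : exists u, extension_operator A (2 * k + 1) u.
Proof.
exists u; split.
- move=> f cf y; apply: cvgB; last exact/P_continuous/continuousN.
  by apply: cvgD; [exact: cvg_cst | exact: P_continuous].
- move=> f x cf Ax; rewrite /u !P_id //; last exact: continuousN.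
  by rewrite !maxEge; case: ifPn; case: ifPn; rewrite -?ltNge; lra.
- move=> f c y cf; have cNf := continuousN cf.
  have NE : (fun x => - (c * f x)) = (fun x => (- c) * f x).
    by apply/funext => x; rewrite mulNr.
  have NE' : (fun x => c * f x) = (fun x => (- c) * - f x).
    by apply/funext => x; rewrite mulrNN.
  have NE'' : (fun x => (- c) * f x) = (fun x => c * - f x).
    by apply/funext => x; rewrite mulrN mulNr.
  (* A negative factor interchanges the two suprema. *)
  have [c0|c0] := leP 0 c; first by rewrite /u NE NE'' !P_scale //; lra.
  have c0' : 0 <= - c by lra.
  by rewrite /u NE NE' !P_scale //; lra.
- move=> f c y cf; have cNf := continuousN cf.
  have NE : (fun x => - (f x + c)) = (fun x => - f x + - c).
    by apply/funext => x; rewrite opprD.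
  by rewrite /u NE !P_add //; lra.
- move=> f a b y cf fab; have cNf := continuousN cf.
  have /andP[pa pb] := fab p Ap.
  have Pb : P f y <= b - f p.
    apply: sup0_le; first lra.
    move=> C CCC; apply: v_le => // [|x Cx]; first lra.
    by have /andP[_ ?] := fab x (CA CCC Cx); lra.
  have Pa : P (fun x => - f x) y <= f p - a.
    apply: sup0_le; first lra.
    move=> C CCC; apply: v_le => // [|x Cx]; first lra.
    by have /andP[? _] := fab x (CA CCC Cx); lra.
  have := P_ge0 y cf; have := P_ge0 y cNf; rewrite /u => ? ?.
  by apply/andP; split; lra.
- move=> f g d y cf cg fg; rewrite ler_norml.
  have := u_le y cf cg fg; have := @u_le g f d y cg cf.
  move=> /(_ (fun x Ax => ltac:(rewrite distrC; exact: fg))) ? ?.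
  by apply/andP; split; lra.
Qed.

End cone.

End extension_operators.

(** * Induction along the Cantor-Bendixson derivatives *)

Section height_induction.
Context {R : realType} {X Y : topologicalType} (e : X -> Y).
Hypotheses (Xc : compact [set: X]) (Xh : hausdorff_space X).
Hypotheses (Xp : hereditarily_paracompact X) (Xs : scattered X).
Hypotheses (Yc : compact [set: Y]) (Yh : hausdorff_space Y) (eE : embedding e).
Implicit Types (A C D : set X) (p : X) (n : nat).

Let zX : zero_dimensional X.
Proof. exact: scattered_zero_dimensional. Qed.

Let extensible A (k : R) := exists u, extension_operator e A k u.

(** The pieces covering [A] without [p] miss [D], so they have operators with constant [2 ^+ n - 1],
    and the cone turns [k] into [2 * k + 1]. *)
Lemma extension_near_point D n A p :
  (forall C, clopen C -> C !=set0 -> C `&` D = set0 ->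
     extensible C (2 ^+ n - 1)) ->
  clopen A -> A p -> A `&` D `<=` [set p] -> extensible A (2 ^+ n.+1 - 1).
Proof.
move=> extC [oA cA] Ap AD.
have oU : open (A `\` [set p]).
  apply: openI => //; apply: closed_openC.
  by apply: compact_closed => //; exact: compact_set1.
have [CC [CCcover CCclopen CCfinite]] :=
  compact_open_cover Xc Xh zX oU (@Xp (A `\` [set p])).
have /choice[h hC] C : exists h : Y -> R, CC C -> [/\ continuous h,
    forall y, 0 <= h y <= 1, forall x, C x -> h (e x) = 1 &
    forall x, ~ C x -> h (e x) = 0].
  have [/CCclopen[cC _ _]|nC] := pselect (CC C); last by exists (cst 0).
  by have [h hP] := clopen_bump Xc Yc Yh eE cC (R := R); exists h.
have /choice[U UE] C : exists u, CC C ->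
    extension_operator e C (2 ^+ n - 1 : R) u.
  have [/CCclopen[cC C0 CA]|nC] := pselect (CC C); last first.
    by exists (fun _ _ => 0).
  have [|u uE] := extC C cC C0; last by exists u.
  by rewrite -subset0 => x [/CA[Ax nx] Dx]; apply: nx; exact: AD.
have -> : 2 ^+ n.+1 - 1 = 2 * (2 ^+ n - 1) + 1 :> R by rewrite exprS; lra.
apply: (extension_cone (h := h) (U := U) Xc _ cA Ap CCcover CCfinite hC UE).
by rewrite subr_ge0 exprn_ege1 // ler1n.
Qed.

(** Induction on a list of the points of [D] in [A]: a clopen [C] around [p] that avoids the
    remaining points is split off, and the union costs nothing in the constant. *)
Lemma extension_finite_trace D n A :
  (forall C, clopen C -> C !=set0 -> C `&` D = set0 ->
     extensible C (2 ^+ n - 1)) ->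
  clopen A -> A !=set0 -> finite_set (A `&` D) -> extensible A (2 ^+ n.+1 - 1).
Proof.
move=> extC cA A0 /finite_seqP[s sE].
have {sE} : A `&` D `<=` [set` s] by rewrite sE.
elim: s A cA A0 => [|p s IH] A cA [a Aa] ADs.
  (* When [A] misses [D], any point of [A] can serve as the apex. *)
  by apply: (@extension_near_point D n A a) => // x /ADs.
have [sub|nsub] := pselect (A `&` D `<=` [set` s]).
  by apply: IH => //; exists a.
have Ap : A p.
  apply: contrapT => nAp; apply: nsub => x [Ax Dx].
  have := ADs x (conj Ax Dx); rewrite /= inE => /predU1P[xp|//].
  by case: nAp; rewrite -xp.
have ps : p \notin s.
  apply/negP => ps; apply: nsub => x /ADs /=.
  by rewrite inE => /predU1P[->|].
have os : open (A `&` ~` [set` s]).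
  apply: openI; first exact: cA.1.
  apply: closed_openC; apply: compact_closed => //.
  by apply: finite_compact; apply/finite_seqP; exists s.
have [|C [Cp cC] CA] := zero_dimensional_cvg Xh zX Xc
    (open_nbhs_nbhs (conj os (conj Ap _ : (A `&` ~` [set` s]) p))).
  exact/negP.
have extCp : extensible C (2 ^+ n.+1 - 1).
  apply: (@extension_near_point D n C p) => // x [/CA[Ax ns] Dx].
  by have := ADs x (conj Ax Dx); rewrite /= inE => /predU1P[].
have CsA : C `<=` A by move=> x /CA[].
rewrite -(setDUK CsA).
have [->|/set0P AC0] := eqVneq (A `\` C) set0; first by rewrite setU0.
have cAC : clopen (A `\` C) by apply: clopenI => //; exact: (clopenC setT).
apply: extension_union => //.
- by rewrite setIDA setIC -setIDA setDv setI0.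
- by exists p.
- by rewrite subr_ge0 exprn_ege1 // ler1n.
apply: IH => // x [[Ax nCx] Dx].
have := ADs x (conj Ax Dx); rewrite /= inE => /predU1P[xp|//].
by case: nCx; rewrite xp.
Qed.

(** If [C] misses the derivative of order [n.+1], all points of [C] in the derivative of order [n]
    are isolated there, hence finite in number by compactness, and induction applies. For [n = 0] no
    nonempty [C] misses the whole space. *)
Lemma extension_finite_height n A :
  clopen A -> A !=set0 -> finite_set (A `&` cb_derivative X n) ->
  extensible A (2 ^+ n.+1 - 1).
Proof.
elim: n A => [|n IH] A cA A0 fA;
  apply: extension_finite_trace fA => // C cC [c Cc] CD.
  by exfalso; rewrite -[False]/(set0 c) -CD.
apply: IH => //; first by exists c.
apply: (discrete_trace_finite Xc) => //; first exact: cC.2.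
  exact: closed_cb_derivative.
move=> x Cx Dx; apply: contrapT => nx.
by rewrite -[False]/(set0 x) -CD.
Qed.

End height_induction.

(** * From extension operators to valued retractions *)

Lemma F_sub_point (R : realType) (X : topologicalType) (n : nat) (x : X)
    (mu : functional R X) :
  (forall f : continuousType X R, mu f = f x) -> F_sub (Fn R n) [set x] mu.
Proof.
move=> muE.
pose pt : set_type [set x] := SigSub (mem_set (erefl x : [set x] x)).
have ptE z : z = pt by apply: val_inj; rewrite /= (set_valP z).
exists (fun f => f pt); last by apply/funext => f; rewrite muE.
split=> // f g.
have -> : sup_norm (f \- g) = `|f pt - g pt|.
  rewrite /sup_norm -[RHS]sup1; congr sup.
  by apply/seteqP; split=> [_ [z _ <-]|_ ->]; [rewrite (ptE z) | exists pt].
(* Evaluation is 1-Lipschitz, and [2 ^+ n.+1 - 1 >= 1]. *)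
rewrite ler_peMl // lerBrDr exprS mulr_natl mulr2n lerD //;
  by rewrite exprn_ege1 // ler1n.
Qed.

Theorem theorem4p7 (R : realType) (X : topologicalType) (s : nat)
    (X_nonempty : [set: X] !=set0)
    (X_compact : compact [set: X])
    (X_hausdorff : hausdorff_space X)
    (X_hereditarily_paracompact : hereditarily_paracompact X)
    (X_scattered : scattered X)
    (X_height : scattered_height_is X s) :
  absolute_valued_retract (Fn R s.+1) X.
Proof.
move=> Y e Yc Yh eE.
have [u uE] : exists u, extension_operator e [set: X] (2 ^+ s.+1 - 1 : R) u.
  apply: extension_finite_height => //; first exact: clopenT.
  by rewrite setTI; exact: X_height.1.
(* The constant is raised to the one in [Fn R s.+1], whose exponent is [s.+2]. *)
have {}uE : extension_operator e [set: X] (2 ^+ s.+2 - 1 : R) u.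
  by apply: ext_le uE => //; rewrite lerD2r ler_eXn2l // ltr1n.
have cf (f : continuousType X R) : continuous f by exact: cts_fun.
have uc c y : u (cst c) y = c.
  apply/eqP; rewrite eq_le andbC; apply: (ext_order uE) => [|x _].
    exact: cst_continuous.
  by rewrite lexx.
pose mu y : functional R X := fun f => u f y.
have muF y : Fn R s.+1 X (mu y).
  split.
  - by move=> c; exact: uc.
  - by move=> f c; rewrite /mu /= uc; exact: (ext_scale uE).
  - by move=> f c; rewrite /mu /= uc; exact: (ext_add uE).
  - by move=> f a b fab; rewrite /mu /= !uc; exact: (ext_order uE).
  - move=> f g; apply: (ext_lipschitz uE) => // x _.
    have [M fgM] :=
      continuous_bounded X_compact (fun x => cvgB (cf f x) (cf g x)).
    apply: ub_le_sup; last by exists x.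
    by exists M => _ [z _ <-]; exact: fgM.
pose r y : set_type (Fn R s.+1 X) := SigSub (mem_set (muF y)).
exists r.
  (* In the product topology continuity is checked at each [f], where the coordinate of [mu] is the
     continuous function [u f]. *)
  apply: continuous_comp_initial => y.
  apply/cvg_sup => f.
  apply: (@continuous_comp_initial _ _ _ (fun g : functional R X => g f) mu).
  exact: (ext_continuous uE).
by move=> x; apply: F_sub_point => f; exact: (ext_id uE).
Qed.
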